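(* There exist a complex Hilbert space and two unbounded self-adjoint operators $A$ and $B$ on it such that $D(A)=D(B)$, $A^2-B^2$ is bounded, but $AB-BA$ is unbounded.
   Context: Operators are linear maps $T$ defined on a linear subspace $D(T)$ of a Hilbert space $\mathcal H$ with values in $\mathcal H$. An operator $T$ is called bounded if there is a constant $M\ge 0$ with $\|Tx\|\le M\|x\|$ for all $x\in D(T)$ (boundedness is on its own domain, which need not be all of $\mathcal H$), and unbounded otherwise. Products and differences have their natural domains $D(ST)=\{x\in D(T): Tx\in D(S)\}$ and $D(S-T)=D(S)\cap D(T)$; $A^2=AA$. *)

(* Defs.v *)
From HB Require Import structures.
From mathcomp Require Import all_boot all_order all_algebra.
From mathcomp Require Import all_classical all_reals all_analysis.
From mathcomp Require Import complex.

Set Implicit Arguments.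
Unset Strict Implicit.
Unset Printing Implicit Defensive.

Import Order.TTheory GRing.Theory Num.Theory.
Import numFieldNormedType.Exports.

Local Open Scope classical_set_scope.
Local Open Scope complex_scope.
Local Open Scope ring_scope.

(* The inner product is linear in its first argument and conjugate-linear in
   its second one. *)
HB.mixin Record CompleteNormedModule_isHilbert (R : realType) V
    & CompleteNormedModule R[i] V := {
  inner : {dot V for (@Num.conj R[i])} ;
  inner_norm : forall x : V, `|x| ^+ 2 = inner x x
}.

#[short(type="hilbertType")]
HB.structure Definition Hilbert (R : realType) :=
  {V of CompleteNormedModule R[i] V & CompleteNormedModule_isHilbert R V}.

Notation "'<< x , y >>" := (inner x y) (format "''<<' x ,  y >>") : ring_scope.

Section operators.
Variables (R : realType) (H : hilbertType R).

(* [op_fun] is total, but its values outside [op_dom] are irrelevant: nothing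
   below depends on them, and [op_eq] is the equality of operators. *)
Record operator := Operator {
  op_dom : set H ;
  op_fun :> H -> H ;
  op_dom0 : op_dom 0 ;
  op_domP : forall (a : R[i]) x y,
    op_dom x -> op_dom y -> op_dom (a *: x + y) ;
  op_linear : forall (a : R[i]) x y, op_dom x -> op_dom y ->
    op_fun (a *: x + y) = a *: op_fun x + op_fun y
}.

Implicit Types S T : operator.

Definition op_eq S T := op_dom S = op_dom T /\ {in op_dom T, S =1 T}.

Definition op_bounded T := exists M : R,
  0 <= M /\ forall x, op_dom T x -> `|T x| <= M%:C * `|x|.

Definition op_unbounded T := ~ op_bounded T.

Section product.
Variables S T : operator.

Let dom : set H := [set x | op_dom T x /\ op_dom S (T x)].

Let dom0 : dom 0.
Proof.
have T0 : T 0 = 0.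
  have := op_linear (-1) (op_dom0 T) (op_dom0 T).
  by rewrite scaler0 addr0 scaleN1r addNr.
by split; rewrite ?T0; exact: op_dom0.
Qed.

Let domP (a : R[i]) x y : dom x -> dom y -> dom (a *: x + y).
Proof.
move=> [Tx STx] [Ty STy]; split; first exact: op_domP.
by rewrite op_linear//; exact: op_domP.
Qed.

Let lin (a : R[i]) x y : dom x -> dom y ->
  S (T (a *: x + y)) = a *: S (T x) + S (T y).
Proof. by move=> [Tx STx] [Ty STy]; rewrite !op_linear. Qed.

Definition op_mul : operator := Operator dom0 domP lin.

End product.

Section difference.
Variables S T : operator.

Let dom : set H := op_dom S `&` op_dom T.

Let dom0 : dom 0.
Proof. by split; exact: op_dom0. Qed.

Let domP (a : R[i]) x y : dom x -> dom y -> dom (a *: x + y).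
Proof. by move=> [Sx Tx] [Sy Ty]; split; exact: op_domP. Qed.

Let lin (a : R[i]) x y : dom x -> dom y ->
  S (a *: x + y) - T (a *: x + y) = a *: (S x - T x) + (S y - T y).
Proof.
by move=> [Sx Tx] [Sy Ty]; rewrite !op_linear// scalerBr opprD addrACA.
Qed.

Definition op_sub : operator :=
  @Operator dom (fun x => S x - T x) dom0 domP lin.

End difference.

Definition op_sqr T := op_mul T T.

Section adjoint.
Variable T : operator.

Definition adjoint_rel (y z : H) :=
  forall x, op_dom T x -> '<<T x, y>> = '<<x, z>>.

Let dom : set H := [set y | exists z, adjoint_rel y z].

Definition adjoint_fun (y : H) : H := xget 0 (adjoint_rel y).

Lemma adjoint_rel_linear (a : R[i]) y z y' z' :
  adjoint_rel y z -> adjoint_rel y' z' ->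
  adjoint_rel (a *: y + y') (a *: z + z').
Proof.
by move=> yz yz' x Dx; rewrite !linearDr !linearZr_LR /= yz // yz'.
Qed.

Lemma adjoint_funP y : dom y -> adjoint_rel y (adjoint_fun y).
Proof. by move=> [z yz]; rewrite /adjoint_fun; case: xgetP => // /(_ z). Qed.

Hypothesis dT : dense (op_dom T).

Lemma adjoint_rel_unique y z z' : adjoint_rel y z -> adjoint_rel y z' -> z = z'.
Proof.
move=> yz yz'; apply/eqP; rewrite -subr_eq0; apply/negPn/negP => w0.
set w := z - z' in w0.
have orth x : op_dom T x -> '<<x, w>> = 0.
  by move=> Dx; rewrite linearBr /= -yz // -yz' // subrr.
have [|x [/= wx Dx]] := @dT (ball w `|w|) _ (ball_open w `|w|).
  by exists w; apply: ballxx; rewrite normr_gt0.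
have xw0 : '<<w, x>> = 0.
  have -> : '<<w, x>> = (-1) ^+ false * Num.conj '<<x, w>>.
    exact: hermitian_subproof.
  by rewrite orth// conjC0 mulr0.
have : `|w - x| ^+ 2 = `|w| ^+ 2 + `|x| ^+ 2.
  have E : '<<w - x, w - x>> = '<<w, w>> - '<<x, w>> - ('<<w, x>> - '<<x, x>>).
    by rewrite linearBr !linearBl.
  by rewrite !inner_norm E xw0 (orth x)// subr0 sub0r opprK.
move: wx; rewrite -ball_normE /= => wx nE.
have : `|w - x| ^+ 2 < `|w| ^+ 2 by rewrite ltr_pXn2r// nnegrE.
by rewrite nE gtrDl le_gtF ?exprn_ge0.
Qed.

Let dom0 : dom 0.
Proof. by exists 0 => x _; rewrite !linear0r. Qed.

Let domP (a : R[i]) x y : dom x -> dom y -> dom (a *: x + y).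
Proof.
by move=> [z xz] [z' yz']; exists (a *: z + z'); exact: adjoint_rel_linear.
Qed.

Let lin (a : R[i]) x y : dom x -> dom y ->
  adjoint_fun (a *: x + y) = a *: adjoint_fun x + adjoint_fun y.
Proof.
move=> Dx Dy; apply: (@adjoint_rel_unique (a *: x + y)).
  by apply: adjoint_funP; exact: domP.
by apply: adjoint_rel_linear; exact: adjoint_funP.
Qed.

Definition adjoint : operator := Operator dom0 domP lin.

End adjoint.

Definition self_adjoint T :=
  exists dT : dense (op_dom T), op_eq (adjoint dT) T.

End operators.

Arguments adjoint {R H T} dT.

(* Main.v *)
Require Import Defs.
From HB Require Import structures.
From mathcomp Require Import all_boot all_order all_algebra.
From mathcomp Require Import all_classical all_reals all_analysis.
From mathcomp Require Import complex.
From mathcomp Require Import ring lra.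

Set Implicit Arguments.
Unset Strict Implicit.
Unset Printing Implicit Defensive.

Import Order.TTheory GRing.Theory Num.Theory.
Import numFieldNormedType.Exports.

(** The example is a direct sum of two-dimensional blocks.  Let sigma_x and
sigma_z be the real reflections of C^2 that swap the two basis vectors, resp.
negate the second one.  Each squares to the identity, yet they anticommute.
On the Hilbert sum of the planes spanned by e_(2n) and e_(2n+1), take
  A = direct sum of the n sigma_x   and   B = direct sum of the n sigma_z.
Both A and B have norm n on the n-th block, so they are unbounded with the same
domain, namely the x such that the sum over n of n^2 |x_n|^2 is finite, where
x_n is the component of x in the n-th block.  Both squares act as n^2 on the
n-th block, hence A^2 - B^2 is the restriction of 0; but AB - BA is
2 n^2 sigma_x sigma_z there, and sends e_(2n) to 2 n^2 e_(2n+1).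

The ambient space is l2, the square-summable complex sequences.  Its inner
product is a series that converges componentwise in R[i] ([l2_dotP]); the norm
is the one that this inner product defines ([sqrt_dnormD] is its triangle
inequality), and [l2_complete] makes it a Hilbert space.

Both operators have the form (T x)_k = w_k x_(s k), with real weights w
and an involution s that preserves each pair {2n, 2n+1} and the weights.  Such
an operator, on its maximal domain, is self-adjoint ([wperm_self_adjoint]):
symmetry holds because the partial sums of length 2n of <T x, y> and of
<x, T y> coincide, and if <T x, y> = <x, z> for all x in the domain, then the
basis vectors x = e_k force z = T y coordinate by coordinate, so that y is in
the domain. *)

Local Open Scope classical_set_scope.
Local Open Scope complex_scope.
Local Open Scope ring_scope.

(* Otherwise Re and Im denote the projections of a closed field onto its real
   elements, which are again elements of R[i]. *)
Local Notation Re := complex.Re.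
Local Notation Im := complex.Im.

(** * The norm of a positive definite hermitian form *)

Section dot_norm.
Variables (C : numClosedFieldType) (U : lmodType C).
Variable form : {dot U for (@Num.conj C)}.

Local Notation "'[ u , v ]" := (form u v).

(** Splitting u = w + a v with w orthogonal to v, Pythagoras gives
<u, u> >= |a|^2 <v, v>, and a <v, v> = <u, v>. *)
Lemma dot_CauchySchwarz u v : `|'[u, v]| ^+ 2 <= '[u, u] * '[v, v].
Proof.
have [-> | v0] := eqVneq v 0.
  by rewrite !linear0r normr0 expr0n.
have v_gt0 : 0 < '[v, v] by rewrite dnorm_gt0.
pose a := '[u, v] / '[v, v]; pose w := u - a *: v.
have wv : '[w, v] = 0.
  by rewrite linearBl/= linearZl_LR/= divfK ?subrr// gt_eqF.
have -> : '[u, u] = '[w, w] + `|a| ^+ 2 * '[v, v].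
  rewrite -dnormZ -hnormDd ?subrK//.
  by rewrite linearZr_LR/= wv mulr0.
have <- : `|a| * '[v, v] = `|'[u, v]|.
  by rewrite normrM normfV (ger0_norm (ltW v_gt0)) divfK ?gt_eqF.
rewrite mulrDl -mulrA -expr2 -exprMn.
by rewrite lerDr mulr_ge0 ?dnorm_ge0.
Qed.

Lemma sqrt_dnormD u v :
  sqrtC '[u + v, u + v] <= sqrtC '[u, u] + sqrtC '[v, v].
Proof.
have su w : 0 <= sqrtC '[w, w] by rewrite sqrtC_ge0 dnorm_ge0.
rewrite -(ler_pXn2r (ltn0Sn 1)) ?nnegrE ?addr_ge0// sqrtCK sqrrD !sqrtCK.
rewrite dnormD/= [leRHS]addrAC lerD2l.
apply: (@le_trans _ _ (`|'[u, v]| *+ 2)).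
  apply: le_trans (real_ler_norm _) _.
    by rewrite CrealE rmorphD/= conjCK addrC.
  by rewrite (le_trans (ler_normD _ _))// norm_conjC mulr2n.
rewrite lerMn2r/= -(ler_pXn2r (ltn0Sn 1)) ?nnegrE ?mulr_ge0//.
by rewrite exprMn !sqrtCK dot_CauchySchwarz.
Qed.

Lemma sqrt_dnormZ a u : sqrtC '[a *: u, a *: u] = `|a| * sqrtC '[u, u].
Proof.
by rewrite dnormZ sqrtCM ?nnegrE ?exprn_ge0 ?dnorm_ge0// sqrCK.
Qed.

End dot_norm.

(** * Limits and absolute values of complex numbers *)

Section complex_limits.
Variables (R : realType) (T : Type) (F : set_system T).
Context {FF : ProperFilter F}.
Implicit Types (u v : T -> R[i]) (a b c : R[i]).

(** Componentwise convergence reduces every question about limits, including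
completeness, to the real line. *)
Definition cvgC u a :=
  Re (u t) @[t --> F] --> Re a /\ Im (u t) @[t --> F] --> Im a.

Lemma cvgC_unique u a b : cvgC u a -> cvgC u b -> a = b.
Proof.
move=> [ra ia] [rb ib]; apply/eqP; rewrite eq_complex.
apply/andP; split; apply/eqP.
  exact: norm_cvg_unique ra rb.
exact: norm_cvg_unique ia ib.
Qed.

Lemma eq_cvgC u v a : u =1 v -> cvgC u a -> cvgC v a.
Proof. by move=> /funext ->. Qed.

Lemma cvgC_cst a : cvgC (fun=> a) a.
Proof. by split; exact: cvg_cst. Qed.

Lemma cvgCD u v a b : cvgC u a -> cvgC v b -> cvgC (fun t => u t + v t) (a + b).
Proof.
move=> [ra ia] [rb ib]; rewrite /cvgC !raddfD/=.
by split; under eq_cvg do rewrite raddfD; exact: cvgD.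
Qed.

Lemma cvgCB u v a b : cvgC u a -> cvgC v b -> cvgC (fun t => u t - v t) (a - b).
Proof.
move=> [ra ia] [rb ib]; rewrite /cvgC !raddfB/=.
by split; under eq_cvg do rewrite raddfB; exact: cvgB.
Qed.

Lemma ReM c a : Re (c * a) = Re c * Re a - Im c * Im a.
Proof. by case: c a => [? ?] [? ?]. Qed.

Lemma ImM c a : Im (c * a) = Re c * Im a + Im c * Re a.
Proof. by case: c a => [? ?] [? ?]. Qed.

Lemma cvgCM u v a b : cvgC u a -> cvgC v b -> cvgC (fun t => u t * v t) (a * b).
Proof.
move=> [ra ia] [rb ib]; rewrite /cvgC ReM ImM; split.
  by under eq_cvg do rewrite ReM; apply: cvgB; exact: cvgM.
by under eq_cvg do rewrite ImM; apply: cvgD; exact: cvgM.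
Qed.

Lemma Re_conj a : Re a^* = Re a.
Proof. by case: a. Qed.

Lemma Im_conj a : Im a^* = - Im a.
Proof. by case: a. Qed.

Lemma cvgC_conj u a : cvgC u a -> cvgC (fun t => (u t)^*) a^*.
Proof.
move=> [ra ia]; rewrite /cvgC Re_conj Im_conj; split.
  by under eq_cvg do rewrite Re_conj.
by under eq_cvg do rewrite Im_conj; exact: cvgN.
Qed.

End complex_limits.

Section sqabs.
Variable R : realType.
Implicit Types z : R[i].

(** The squared modulus as an element of R, where the order is total and bounded
monotone sequences converge. *)
Definition sqabs z : R := Re z ^+ 2 + Im z ^+ 2.

Lemma sqabsE z : (sqabs z)%:C = `|z| ^+ 2.
Proof. exact: add_Re2_Im2. Qed.

Lemma sqabs_ge0 z : 0 <= sqabs z.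
Proof. by rewrite addr_ge0 ?sqr_ge0. Qed.

Lemma sqabsM z z' : sqabs (z * z') = sqabs z * sqabs z'.
Proof. by rewrite /sqabs ReM ImM; ring. Qed.

Lemma sqabsD z z' : sqabs (z + z') <= 2 * sqabs z + 2 * sqabs z'.
Proof.
rewrite /sqabs !raddfD/=.
by have := sqr_ge0 (Re z - Re z'); have := sqr_ge0 (Im z - Im z'); nra.
Qed.

Lemma sqabs_eq0 z : (sqabs z == 0) = (z == 0).
Proof.
by rewrite -(inj_eq (@complexI R)) sqabsE expf_eq0 normr_eq0.
Qed.

End sqabs.

(** * The inner product space l2 *)

Section square_summable.
Variable R : realType.
Implicit Types x y : nat -> R[i].

Definition sqsummable : {pred nat -> R[i]} :=
  fun x => `[< cvgn (series (fun k => sqabs (x k))) >].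

Lemma sqsummableP x : reflect
  (exists M, forall n, \sum_(0 <= k < n) sqabs (x k) <= M) (x \in sqsummable).
Proof.
apply: (iffP (asboolP _)) => [cvgx|[M xM]].
  exists (limn (series (fun k => sqabs (x k)))) => n.
  apply: (nondecreasing_cvgn_le _ cvgx n).
  by apply: nondecreasing_series => k _ _; exact: sqabs_ge0.
apply: nondecreasing_is_cvgn.
  by apply: nondecreasing_series => k _ _; exact: sqabs_ge0.
by exists M => _ [n _ <-]; exact: xM.
Qed.

Lemma sqsummable_le x y : (forall k, sqabs (x k) <= sqabs (y k)) ->
  y \in sqsummable -> x \in sqsummable.
Proof.
move=> xy /sqsummableP[M yM]; apply/sqsummableP; exists M => n.
by apply: le_trans (yM n); exact: ler_sum.
Qed.

Lemma sqsummable_submod_closed : submod_closed sqsummable.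
Proof.
split=> [|a x y /sqsummableP[M xM] /sqsummableP[N yN]].
  apply/sqsummableP; exists 0 => n; rewrite big1// => k _.
  by apply/eqP; rewrite sqabs_eq0.
apply/sqsummableP; exists (2 * sqabs a * M + 2 * N) => n.
apply: (@le_trans _ _ (\sum_(0 <= k < n)
    (2 * sqabs a * sqabs (x k) + 2 * sqabs (y k)))).
  apply: ler_sum => k _; apply: le_trans (sqabsD (a * x k) (y k)) _.
  by rewrite sqabsM mulrA.
rewrite big_split/= -!mulr_sumr lerD ?ler_wpM2l ?mulr_ge0 ?sqabs_ge0//.
Qed.

HB.instance Definition _ := GRing.isSubmodClosed.Build R[i] (nat -> R[i])
  sqsummable sqsummable_submod_closed.

End square_summable.

Record l2 (R : realType) := L2 {
  l2_seq :> nat -> R[i] ;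
  l2_seqP : l2_seq \in @sqsummable R }.

HB.instance Definition _ (R : realType) := [isSub for @l2_seq R].
HB.instance Definition _ (R : realType) := [Choice of l2 R by <:].
HB.instance Definition _ (R : realType) :=
  [SubChoice_isSubLmodule of l2 R by <:].

Section l2_inner.
Variable R : realType.
Implicit Types x y z : l2 R.

Lemma l2P x y : (forall k, x k = y k) -> x = y.
Proof. by move=> xy; apply/val_inj/funext. Qed.

Lemma l2D x y k : (x + y) k = x k + y k. Proof. by []. Qed.
Lemma l2Z a x k : (a *: x) k = a * x k. Proof. by []. Qed.

Definition dot_term x y k : R[i] := x k * (y k)^*.

Definition l2_dot x y : R[i] :=
  limn (series (@Re R \o dot_term x y)) +i* limn (series (@Im R \o dot_term x y)).

(** The components of x_k (y_k)^* are at most |x_k|^2 + |y_k|^2 in absolute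
value, so both series converge absolutely.  Every algebraic property of the
inner product follows from this by uniqueness of limits. *)
Lemma l2_dotP x y : cvgC \oo (series (dot_term x y)) (l2_dot x y).
Proof.
have xy_cvg (f : nat -> R) :
    (forall k, `|f k| <= sqabs (x k) + sqabs (y k)) -> cvgn (series f).
  move=> fxy; apply: (@normed_cvg R R^o).
  apply: (series_le_cvg _ _ fxy) => [k|k|].
  - exact: normr_ge0.
  - by rewrite addr_ge0 ?sqabs_ge0.
  - by apply: is_cvg_seriesD; apply/asboolP; exact: l2_seqP.
split=> /=.
  rewrite (_ : (fun n => _) = series (@Re R \o dot_term x y)).
    apply: xy_cvg => k /=.
    rewrite /dot_term/sqabs ReM Re_conj Im_conj ler_norml.
    move: (Re (x k)) (Im (x k)) (Re (y k)) (Im (y k)) => a b c d.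
    have := sqr_ge0 (a - c); have := sqr_ge0 (a + c).
    have := sqr_ge0 (b - d); have := sqr_ge0 (b + d).
    by move=> *; apply/andP; split; lra.
  by apply/funext => n; rewrite /series/= raddf_sum.
rewrite (_ : (fun n => _) = series (@Im R \o dot_term x y)).
  apply: xy_cvg => k /=.
  rewrite /dot_term/sqabs ImM Re_conj Im_conj ler_norml.
  move: (Re (x k)) (Im (x k)) (Re (y k)) (Im (y k)) => a b c d.
  have := sqr_ge0 (a - d); have := sqr_ge0 (a + d).
  have := sqr_ge0 (b - c); have := sqr_ge0 (b + c).
  by move=> *; apply/andP; split; lra.
by apply/funext => n; rewrite /series/= raddf_sum.
Qed.

Lemma l2_dotE x y a : cvgC \oo (series (dot_term x y)) a -> l2_dot x y = a.
Proof. exact: cvgC_unique (l2_dotP x y). Qed.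

Lemma l2_dotC x y : l2_dot x y = (l2_dot y x)^*.
Proof.
apply: l2_dotE; apply: eq_cvgC (cvgC_conj (l2_dotP y x)) => n. rewrite /series/= rmorph_sum/=; apply: eq_bigr => k _.
by rewrite /dot_term rmorphM/= conjCK mulrC.
Qed.

Lemma l2_dot_linear y : linear_for *%R (l2_dot ^~ y).
Proof.
move=> a x z; apply: l2_dotE.
apply: eq_cvgC (cvgCD (cvgCM (cvgC_cst a) (l2_dotP x y)) (l2_dotP z y)) => n.
 rewrite /series/= mulr_sumr -big_split/=.
by apply: eq_bigr => k _; rewrite /dot_term mulrDl mulrA.
Qed.

Lemma l2_dotr_linear x : linear_for (Num.conj \; *%R) (l2_dot x).
Proof.
move=> a y z /=; rewrite l2_dotC l2_dot_linear rmorphD rmorphM/=.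
by rewrite -!l2_dotC.
Qed.

HB.instance Definition _ := bilinear_isBilinear.Build R[i] (l2 R) (l2 R) R[i]
  *%R (Num.conj \; *%R) l2_dot (l2_dot_linear, l2_dotr_linear).

Lemma l2_dot_hermitian x y : l2_dot x y = (-1) ^+ false * (l2_dot y x)^*.
Proof. by rewrite expr0 mul1r -l2_dotC. Qed.

HB.instance Definition _ := @isHermitianSesquilinear.Build _ _ _ _ _
  l2_dot_hermitian.

Definition sqnorm x : R := limn (series (fun k => sqabs (x k))).

Lemma is_cvg_sqabs x : cvgn (series (fun k => sqabs (x k))).
Proof. by apply/asboolP; exact: l2_seqP. Qed.

Lemma sqnorm_ge x n : \sum_(0 <= k < n) sqabs (x k) <= sqnorm x.
Proof.
apply: (nondecreasing_cvgn_le _ (@is_cvg_sqabs x) n).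
by apply: nondecreasing_series => k _ _; exact: sqabs_ge0.
Qed.

Lemma sqnorm_le x r : (forall n, \sum_(0 <= k < n) sqabs (x k) <= r) ->
  sqnorm x <= r.
Proof.
by move=> xr; apply: limr_le; [exact: is_cvg_sqabs|exact: nearW].
Qed.

Lemma dot_sqnorm x : l2_dot x x = (sqnorm x)%:C.
Proof.
apply: l2_dotE; have E n : series (dot_term x x) n =
    (series (fun k => sqabs (x k)) n)%:C.
  rewrite /series/= raddf_sum; apply: eq_bigr => k _.
  by rewrite /dot_term -normCK -sqabsE.
split=> /=.
  under eq_cvg do rewrite E; exact: is_cvg_sqabs.
by under eq_cvg do rewrite E; exact: cvg_cst.
Qed.

Lemma l2_dot_gt0 x : x != 0 -> 0 < l2_dot x x.
Proof.
move=> x0; rewrite dot_sqnorm ltcR.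
have [k xk] : exists k, x k != 0.
  apply: contrapT => /forallNP xk; move/eqP: x0; apply; apply: l2P => k.
  by apply/eqP/negPn/negP; exact: xk.
apply: lt_le_trans (sqnorm_ge x k.+1).
rewrite big_nat_recr//= ltr_wpDl ?sumr_ge0// => [i _|].
  exact: sqabs_ge0.
by rewrite lt_neqAle eq_sym sqabs_eq0 xk sqabs_ge0.
Qed.

HB.instance Definition _ := isDotProduct.Build _ _ l2_dot l2_dot_gt0.

End l2_inner.

(** * Completeness of l2 *)

Section l2_norm.
Variable R : realType.
Implicit Types x y : l2 R.

Lemma l2_norm_eq0 x : sqrtC (l2_dot x x) = 0 -> x = 0.
Proof. by move/eqP; rewrite sqrt_dnorm_eq0 => /eqP. Qed.

HB.instance Definition _ := Lmodule_isNormed.Build R[i] (l2 R)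
  (@sqrt_dnormD _ _ (@l2_dot R)) (@sqrt_dnormZ _ _ (@l2_dot R)) l2_norm_eq0.

Lemma l2_inner_norm x : `|x| ^+ 2 = l2_dot x x.
Proof. by rewrite sqrtCK. Qed.

Lemma sqr_l2_norm x : `|x| ^+ 2 = (sqnorm x)%:C.
Proof. by rewrite l2_inner_norm dot_sqnorm. Qed.

Lemma l2_norm_le x (r : R) : 0 <= r ->
  (`|x| <= r%:C) = (sqnorm x <= r ^+ 2).
Proof.
move=> r0; rewrite -(ler_pXn2r (ltn0Sn 1)) ?nnegrE ?ler0c//.
by rewrite sqr_l2_norm -rmorphXn lecR.
Qed.

Lemma sqabs_coord x k : sqabs (x k) <= sqnorm x.
Proof.
apply: le_trans (sqnorm_ge x k.+1); rewrite big_nat_recr//= lerDr sumr_ge0//.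
by move=> i _; exact: sqabs_ge0.
Qed.

Lemma l2_coord_le x k : `|x k| <= `|x|.
Proof.
by rewrite -(ler_pXn2r (ltn0Sn 1)) ?nnegrE// sqr_l2_norm -sqabsE lecR sqabs_coord.
Qed.

End l2_norm.

Section l2_complete.
Variable R : realType.

Lemma gt0_realP (e : R[i]) : 0 < e -> exists2 r : R, 0 < r & e = r%:C.
Proof.
move=> e0; exists (Re e); last by rewrite RRe_real// gtr0_real.
by move: e0; rewrite ltcE => /andP[].
Qed.

Lemma abs_Im_le (z : R[i]) : `|Im z|%:C <= `|z|.
Proof.
rewrite -(ler_pXn2r (ltn0Sn 1)) ?nnegrE ?normr_ge0 ?ler0c ?normr_ge0//.
by rewrite -sqabsE -rmorphXn lecR real_normK ?num_real// lerDr sqr_ge0.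
Qed.

Lemma cvg_sqabs T (F : set_system T) {FF : ProperFilter F} (u : T -> R[i]) a :
  cvgC F u a -> sqabs (u t) @[t --> F] --> sqabs a.
Proof. by move=> [ra ia]; apply: cvgD; rewrite expr2; exact: cvgM. Qed.

(** Coordinates are 1-Lipschitz, hence so are their real and imaginary parts,
and the images of F by these are Cauchy filters on R. *)
Lemma l2_cauchy_coord (F : set_system (l2 R)) {FF : ProperFilter F} k :
  cauchy F -> exists a, cvgC F (fun x => x k) a.
Proof.
move=> cF.
have cvg_part (p : R[i] -> R) : (forall z z', p (z - z') = p z - p z') ->
    (forall z, `|p z|%:C <= `|z|) -> cvg (p (x k) @[x --> F]).
  move=> pB ple; apply: cauchy_cvg; apply: cauchy_exP => e e0.
  have /cauchyP/(_ e%:C)[|x0 Fx0] := cF; first by rewrite ltcR.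
  exists (p (x0 k)).
  suff : \forall x \near F, ball (p (x0 k)) e (p (l2_seq x k)) by [].
  apply: filterS Fx0 => x.
  rewrite -ball_normE/= => xe; rewrite -ball_normE/= -pB -ltcR (le_lt_trans (ple _))//.
  exact: le_lt_trans (l2_coord_le (x0 - x) k) xe.
have /cvg_ex[/= r rP] := cvg_part _ (raddfB (@Re R)) (@normc_ge_Re R).
have /cvg_ex[/= s sP] := cvg_part _ (raddfB (@Im R)) abs_Im_le.
by exists (r +i* s); split.
Qed.

(** The limit l is taken coordinatewise.  If the ball of center x and radius r
belongs to F, then the partial sums of |x - y|^2 are at most r^2 for F-almost
all y; each is a finite sum, so the bound passes to y = l.  This shows both that
l = x - (x - l) is square-summable and that F converges to l in norm. *)
Lemma l2_complete (F : set_system (l2 R)) : ProperFilter F -> cauchy F -> cvg F.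
Proof.
move=> FF cF; have [l lP] := choice (fun k => l2_cauchy_coord k cF).
have dist_l x (r : R) : F (ball x r%:C) -> forall n,
    \sum_(0 <= k < n) sqabs (x k - l k) <= r ^+ 2.
  move=> Fx n.
  apply: (@cvgr_to_le _ F _ R (fun y : l2 R => \sum_(0 <= k < n) sqabs (x k - y k))).
    apply: cvg_big => [|k _]; first exact: add_continuous.
    apply: cvg_sqabs.
    by apply: cvgCB (lP k); exact: cvgC_cst.
  apply: filterS Fx => y; rewrite -ball_normE/= => xy.
  apply: le_trans (sqnorm_ge (x - y) n) _.
  rewrite -l2_norm_le ?ltW//.
  by have := le_lt_trans (normr_ge0 _) xy; rewrite ltcR.
have l_l2 : l \in @sqsummable R.
  have /cauchyP/(_ 1%:C)[|x Fx] := cF; first by rewrite ltcR.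
  have -> : l = (x : nat -> R[i]) - (fun k => x k - l k).
    by apply/funext => k; rewrite !fctE opprB addrC subrK.
  rewrite rpredB ?l2_seqP//.
  by apply/sqsummableP; exists (1 ^+ 2); exact: dist_l Fx.
apply/cvg_ex; exists (L2 l_l2).
apply/cvg_ballP => _ /gt0_realP[r r0 ->].
have r20 : 0 < r / 2 by rewrite divr_gt0.
have /cauchyP/(_ (r / 2)%:C)[|x Fx] := cF; first by rewrite ltcR.
apply: filterS (Fx) => y; rewrite -!ball_normE/= => xy.
rewrite [r]splitr rmorphD/= -(subrKA x).
apply: le_lt_trans (ler_normD _ _) _; apply: ler_ltD => //.
rewrite distrC l2_norm_le ?(ltW r20)//; apply: sqnorm_le; exact: dist_l.
Qed.

HB.instance Definition _ := Uniform_isComplete.Build (l2 R) l2_complete.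

HB.instance Definition _ := CompleteNormedModule_isHilbert.Build R (l2 R)
  (@l2_inner_norm R).

End l2_complete.

(** * Sequences of finite support *)

Section finite_support.
Variable R : realType.

Lemma finite_support_sqsummable (x : nat -> R[i]) n :
  (forall k, (n <= k)%N -> x k = 0) -> x \in @sqsummable R.
Proof.
move=> x0; apply/sqsummableP; exists (\sum_(0 <= k < n) sqabs (x k)) => m.
apply: (@le_trans _ _ (\sum_(0 <= k < n + m) sqabs (x k))).
  apply: (nondecreasing_series (u_ := fun k => sqabs (x k))) (leq_addl n m).
  by move=> k _ _; exact: sqabs_ge0.
rewrite (big_cat_nat (leq0n n) (leq_addr m n))/= [X in _ + X]big_nat_cond.
rewrite [X in _ + X]big1 ?addr0// => k /andP[/andP[nk _] _].
by apply/eqP; rewrite sqabs_eq0 x0.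
Qed.

Lemma l2_single_subproof j : (fun k => (k == j)%:R) \in @sqsummable R.
Proof.
by apply: (@finite_support_sqsummable _ j.+1) => k; case: ltngtP.
Qed.

Definition l2_single j : l2 R := L2 (l2_single_subproof j).

Lemma l2_dot_single j (y : l2 R) : l2_dot (l2_single j) y = (y j)^*.
Proof.
apply: l2_dotE.
have E : \forall n \near \oo, series (dot_term (l2_single j) y) n = (y j)^*.
  exists j.+1 => // n /= jn; rewrite /series/= (bigD1_seq j)/=; last first.
  - exact: iota_uniq.
  - by rewrite mem_index_iota.
  rewrite /dot_term/= eqxx mul1r big1 ?addr0// => k /negPf ->.
  by rewrite mul0r.
by split; apply: cvg_near_cst; apply: filterS E => n ->.
Qed.

Lemma l2_single_norm j : `|l2_single j| = 1.
Proof.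
apply/eqP; rewrite -(@pexpr_eq1 _ _ 2)//.
by rewrite l2_inner_norm l2_dot_single/= eqxx conjC1.
Qed.

Lemma l2_trunc_subproof (x : l2 R) n :
  (fun k => if (k < n)%N then x k else 0) \in @sqsummable R.
Proof.
by apply: (@finite_support_sqsummable _ n) => k; case: ltnP.
Qed.

Definition l2_trunc x n : l2 R := L2 (l2_trunc_subproof x n).

(** The squared norm of the tail of x is the remainder of the series of x, which
tends to 0. *)
Lemma sqnorm_sub_trunc (x : l2 R) n :
  sqnorm (x - l2_trunc x n) <= sqnorm x - \sum_(0 <= k < n) sqabs (x k).
Proof.
apply: sqnorm_le => m; pose d k := x k - (if (k < n)%N then x k else 0).
apply: (@le_trans _ _ (\sum_(0 <= k < n + m) sqabs (d k))).
  apply: (nondecreasing_series (u_ := fun k => sqabs (d k))) (leq_addl n m).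
  by move=> k _ _; exact: sqabs_ge0.
rewrite lerBrDr; apply: le_trans (sqnorm_ge x (n + m)).
rewrite !(big_cat_nat (leq0n n) (leq_addr m n))/= [leLHS]addrC lerD2l.
rewrite big_nat_cond big1 ?add0r; last first.
  move=> k /andP[/andP[_ kn] _].
  by apply/eqP; rewrite sqabs_eq0 /d kn subrr.
by apply: ler_sum_nat => k /andP[nk _]; rewrite /d ltnNge nk subr0.
Qed.

Lemma l2_trunc_dense (D : set (l2 R)) :
  (forall x n, D (l2_trunc x n)) -> dense D.
Proof.
move=> DT O [x Ox] oO.
have /nbhs_ballP[_ /gt0_realP[r r0 ->] xrO] : nbhs x O by exact: open_nbhs_nbhs.
have r20 : 0 < r / 2 by rewrite divr_gt0.
have /cvgrPdist_le/(_ _ (exprn_gt0 2 r20))[n _ /(_ n (leqnn n)) nP] :=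
  @is_cvg_sqabs R x.
exists (l2_trunc x n); split; last exact: DT.
apply: xrO; rewrite -ball_normE/=.
apply: (@le_lt_trans _ _ (r / 2)%:C).
  rewrite l2_norm_le ?(ltW r20)//; apply: le_trans (sqnorm_sub_trunc x n) _.
  by apply: le_trans nP; exact: ler_norm.
by rewrite ltcR ltr_pdivrMr// ltr_pMr// ltr1n.
Qed.

End finite_support.

(** * Weighted permutation operators *)

Lemma conj_real_complex (R : realType) (r : R) : (r%:C)^* = r%:C.
Proof. exact: conjc_real. Qed.

Section weighted_permutation.
Variables (R : realType) (w : nat -> R) (s : nat -> nat).
Hypothesis sK : involutive s.
Hypothesis s_half : forall k, (s k)./2 = k./2.
Hypothesis ws : forall k, w (s k) = w k.

(** Since s permutes each pair {2i, 2i+1}, it permutes the indices below 2n.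
Partial sums of even length are thus insensitive to s, which spares any
rearrangement theorem for infinite series. *)
Lemma sum_pairs_perm (V : nmodType) (f : nat -> V) n :
  \sum_(0 <= k < n.*2) f (s k) = \sum_(0 <= k < n.*2) f k.
Proof.
rewrite -(big_map s xpredT f); apply: perm_big; apply: uniq_perm.
- by rewrite map_inj_uniq ?iota_uniq//; exact: inv_inj.
- exact: iota_uniq.
move=> k; rewrite -{1}[k]sK mem_map; last exact: inv_inj.
by rewrite !mem_index_iota/= -!ltn_half_double s_half.
Qed.

Lemma sqsummable_perm (x : nat -> R[i]) :
  x \in @sqsummable R -> x \o s \in @sqsummable R.
Proof.
move=> /sqsummableP[M xM]; apply/sqsummableP; exists M => n.
apply: le_trans (xM n.*2); rewrite -(sum_pairs_perm (fun k => sqabs (x k))).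
apply: (nondecreasing_series (u_ := fun k => sqabs (x (s k)))).
  by move=> k _ _; exact: sqabs_ge0.
by rewrite -addnn leq_addr.
Qed.

Definition wperm (x : nat -> R[i]) k := (w k)%:C * x (s k).

(** The domain is written without s so that it only depends on the absolute
values of the weights; [wperm_sqsummable] identifies it with the maximal domain
of the operator. *)
Definition wperm_dom : set (l2 R) :=
  [set x | (fun k => (w k)%:C * x k) \in @sqsummable R].

(** Outside the domain the formula may leave l2, and 0 is used instead. *)
Definition wperm_fun (x : l2 R) : l2 R := insubd 0 (wperm x).

Lemma wperm_sqsummable (x : l2 R) :
  wperm_dom x <-> wperm x \in @sqsummable R.
Proof.
split=> /sqsummable_perm.
  rewrite (_ : _ \o s = wperm x)//; apply/funext => k.
  by rewrite /wperm/= ws.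
rewrite (_ : _ \o s = fun k => (w k)%:C * x k)//; apply/funext => k.
by rewrite /wperm/= ws sK.
Qed.

Lemma wperm_funE x k : wperm_dom x -> wperm_fun x k = (w k)%:C * x (s k).
Proof. by move=> /wperm_sqsummable Tx; rewrite -[LHS]/(val _ k) insubdK. Qed.

Lemma wperm_dom0 : wperm_dom 0.
Proof.
rewrite /wperm_dom/= (_ : (fun _ => _) = 0) ?rpred0//.
by apply/funext => k; exact: mulr0.
Qed.

Lemma wperm_domP (a : R[i]) x y :
  wperm_dom x -> wperm_dom y -> wperm_dom (a *: x + y).
Proof.
move=> Dx Dy; have := rpredD (rpredZ a Dx) Dy.
rewrite /wperm_dom/= [X in X \in _ -> _](_ : _ =
  fun k => (w k)%:C * (a *: x + y) k)//; apply/funext => k.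
by rewrite l2D l2Z mulrDr mulrCA.
Qed.

Lemma wperm_linear (a : R[i]) x y : wperm_dom x -> wperm_dom y ->
  wperm_fun (a *: x + y) = a *: wperm_fun x + wperm_fun y.
Proof.
move=> Dx Dy; apply: l2P => k; rewrite l2D l2Z !wperm_funE//.
  by rewrite l2D l2Z mulrDr mulrCA.
exact: wperm_domP.
Qed.

Definition wperm_op : operator (l2 R) :=
  Operator wperm_dom0 wperm_domP wperm_linear.

Lemma wperm_sqr x k : op_dom (op_sqr wperm_op) x ->
  op_sqr wperm_op x k = (w k ^+ 2)%:C * x k.
Proof.
move=> [Dx DTx]; rewrite [LHS](wperm_funE k DTx) [X in _ * X](wperm_funE _ Dx).
by rewrite ws sK mulrA -rmorphM.
Qed.

Lemma wperm_dom_finite (x : l2 R) n :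
  (forall k, (n <= k)%N -> x k = 0) -> wperm_dom x.
Proof.
move=> x0; apply: (@finite_support_sqsummable _ _ n) => k nk.
by rewrite x0 ?mulr0.
Qed.

Lemma wperm_dom_single j : wperm_dom (l2_single R j).
Proof. by apply: (@wperm_dom_finite _ j.+1) => k; rewrite /=; case: ltngtP. Qed.

Lemma wperm_single j :
  wperm_op (l2_single R j) = (w j)%:C *: l2_single R (s j).
Proof.
apply: l2P => k; rewrite wperm_funE; last exact: wperm_dom_single.
rewrite l2Z/= (can2_eq sK sK); case: eqP => [->|_]; last by rewrite !mulr0.
by rewrite ws.
Qed.

Lemma wperm_dense : dense wperm_dom.
Proof.
apply: l2_trunc_dense => x n; apply: (@wperm_dom_finite _ n) => k /=.
by case: ltnP.
Qed.

(** Reindexing by s turns one inner product into the other on the partial sums of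
even length, and these determine the limits. *)
Lemma wperm_symmetric x y : wperm_dom x -> wperm_dom y ->
  l2_dot (wperm_fun x) y = l2_dot x (wperm_fun y).
Proof.
move=> Dx Dy.
have dbl u (a : R[i]) : cvgC \oo u a -> cvgC \oo (fun n => u n.*2) a.
  have dblo : n.*2 @[n --> \oo] --> \oo.
    by under eq_cvg do rewrite -mul2n; exact: cvg_mulnl.
  by move=> [ra ia]; split; [exact: cvg_comp dblo ra|exact: cvg_comp dblo ia].
apply: cvgC_unique (dbl _ _ (l2_dotP _ y)) _.
apply: eq_cvgC (dbl _ _ (l2_dotP x _)) => n; rewrite /series/=.
rewrite -sum_pairs_perm; apply: eq_bigr => k _.
rewrite /dot_term !wperm_funE// ws sK rmorphM/= conj_real_complex.
by rewrite mulrCA mulrA.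
Qed.

(** Testing the adjoint relation on the k-th basis vector e_k gives the k-th
coordinate of z, because T e_k is w_k times the basis vector of index s k. *)
Lemma wperm_adjoint y z k :
  adjoint_rel wperm_op y z -> z k = (w k)%:C * y (s k).
Proof.
move=> /(_ _ (wperm_dom_single k)); rewrite wperm_single => yz.
have : l2_dot ((w k)%:C *: l2_single R (s k)) y = l2_dot (l2_single R k) z.
  exact: yz.
rewrite linearZl_LR/= !l2_dot_single.
move=> /(congr1 Num.conj); rewrite conjCK => <-; rewrite rmorphM/= conjCK.
by rewrite conj_real_complex.
Qed.

(** By [wperm_adjoint], any y in the domain of the adjoint satisfies
T y = z in l2, which is the condition defining the domain of T. *)
Lemma wperm_self_adjoint : self_adjoint wperm_op.
Proof.
exists wperm_dense.
have adjT y : wperm_dom y -> adjoint_rel wperm_op y (wperm_op y).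
  by move=> Dy x Dx; exact: wperm_symmetric.
split.
  apply/seteqP; split=> y /=; last by move=> Dy; exists (wperm_op y); exact: adjT.
  move=> [z yz]; apply/wperm_sqsummable; rewrite (_ : wperm y = z) ?l2_seqP//.
  by apply/funext => k; rewrite (wperm_adjoint k yz).
move=> y /set_mem Dy; apply: (@adjoint_rel_unique _ _ wperm_op wperm_dense y) _ (adjT _ Dy).
by apply: adjoint_funP; exists (wperm_op y); exact: adjT.
Qed.

End weighted_permutation.

(** * The two operators *)

Section reflections.
Variable R : realType.

Lemma op_unboundedP (H : hilbertType R) (T : operator H) :
  (forall n, exists x : H,
    [/\ op_dom T x, `|x| = 1 & n%:R <= `|T x|]) -> op_unbounded T.
Proof.
move=> Tn [M [M0 TM]]; have [x [Dx x1 nT]] := Tn (Num.truncn M).+1.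
have := le_trans nT (TM x Dx); rewrite x1 mulr1 -(rmorph_nat (real_complex R)).
by rewrite lecR leNgt truncnS_gt.
Qed.

Lemma op_scale (H : hilbertType R) (T : operator H) (a : R[i]) (x : H) :
  op_dom T x -> T (a *: x) = a *: T x /\ op_dom T (a *: x).
Proof.
move=> Dx; have T0 : T 0 = 0.
  have := op_linear (-1) (op_dom0 T) (op_dom0 T).
  by rewrite scaler0 addr0 scaleN1r addNr.
split; have := op_linear a Dx (op_dom0 T); have := op_domP a Dx (op_dom0 T);
  by rewrite T0 !addr0.
Qed.

Definition swap_pair k := if odd k then k.-1 else k.+1.

(** For k = 2n and k = 2n+1, the number k./2 is the index n of the block. *)
Definition swap_weight k : R := k./2%:R.

Definition sign_weight k : R := (-1) ^+ odd k * k./2%:R.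

Lemma swap_pairK : involutive swap_pair.
Proof.
move=> k; rewrite /swap_pair; have [ok|ek] := boolP (odd k).
  by case: k ok => //= k /negPf ->.
by rewrite /= ek.
Qed.

Lemma swap_pair_half k : (swap_pair k)./2 = k./2.
Proof.
rewrite /swap_pair; have [ok|ek] := boolP (odd k).
  by case: k ok => //= k; rewrite uphalf_half => /negPf ->.
by rewrite /= uphalf_half (negPf ek).
Qed.

Lemma swap_weight_swap k : swap_weight (swap_pair k) = swap_weight k.
Proof. by rewrite /swap_weight swap_pair_half. Qed.

Definition swap_op := wperm_op swap_pairK swap_pair_half swap_weight_swap.

Definition sign_op : operator (l2 R) :=
  @wperm_op R sign_weight id (fun=> erefl) (fun=> erefl) (fun=> erefl).

Lemma sqr_sign_weight k : sign_weight k ^+ 2 = swap_weight k ^+ 2.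
Proof. by rewrite exprMn sqrr_sign mul1r. Qed.

Lemma swap_op_single n :
  swap_op (l2_single R n.*2) = n%:R%:C *: l2_single R n.*2.+1.
Proof.
by rewrite wperm_single /swap_weight /swap_pair odd_double doubleK.
Qed.

Lemma sign_op_single n :
  sign_op (l2_single R n.*2) = n%:R%:C *: l2_single R n.*2.
Proof. by rewrite wperm_single /sign_weight odd_double mul1r doubleK. Qed.

Lemma sign_op_singleS n :
  sign_op (l2_single R n.*2.+1) = (- n%:R%:C) *: l2_single R n.*2.+1.
Proof.
rewrite wperm_single /sign_weight/= odd_double expr1 mulN1r uphalf_double.
by rewrite rmorphN.
Qed.

End reflections.

Theorem lemma2p3 (R : realType) :
  exists (H : hilbertType R) (A B : operator H),
    [/\ op_unbounded A /\ self_adjoint A,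
        op_unbounded B /\ self_adjoint B,
        op_dom A = op_dom B,
        op_bounded (op_sub (op_sqr A) (op_sqr B)) &
        op_unbounded (op_sub (op_mul A B) (op_mul B A))].
Proof.
exists (l2 R : hilbertType R), (swap_op R), (sign_op R).
have DA j : op_dom (swap_op R) (l2_single R j) := wperm_dom_single _ _.
have DB j : op_dom (sign_op R) (l2_single R j) := wperm_dom_single _ _.
have nC n : n%:R%:C = n%:R :> R[i] by rewrite rmorph_nat.
split.
- split; last exact: wperm_self_adjoint.
  apply: op_unboundedP => n; exists (l2_single R n.*2); split=> //.
    exact: l2_single_norm.
  by rewrite swap_op_single normrZ l2_single_norm mulr1 nC normr_nat.
- split; last exact: wperm_self_adjoint.
  apply: op_unboundedP => n; exists (l2_single R n.*2); split=> //.
    exact: l2_single_norm.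
  by rewrite sign_op_single normrZ l2_single_norm mulr1 nC normr_nat.
- have sqabsw x k : sqabs ((swap_weight R k)%:C * x) =
      sqabs ((sign_weight R k)%:C * x).
    by rewrite !sqabsM /sqabs/= -sqr_sign_weight.
  by apply/seteqP; split=> x; apply: sqsummable_le => k; rewrite sqabsw.
- exists 0; split=> // x [AAx BBx].
  rewrite (_ : op_sub _ _ x = 0) ?normr0 ?mul0r//.
  apply/eqP; rewrite subr_eq0; apply/eqP/l2P => k.
  by rewrite (wperm_sqr k AAx) (wperm_sqr k BBx) sqr_sign_weight.
apply: op_unboundedP => n; exists (l2_single R n.*2).
(* The vector e_(2n) is sent to n^2 e_(2n+1) by AB and to its opposite by BA. *)
have [ABe DABe] := op_scale n%:R%:C (DA n.*2).
have [BAe DBAe] := op_scale n%:R%:C (DB n.*2.+1).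
split.
- by split; split => //; rewrite ?sign_op_single ?swap_op_single.
- exact: l2_single_norm.
have -> : op_sub (op_mul (swap_op R) (sign_op R))
    (op_mul (sign_op R) (swap_op R)) (l2_single R n.*2) =
    (n * n * 2)%:R *: l2_single R n.*2.+1.
  transitivity ((swap_op R (sign_op R (l2_single R n.*2)) : l2 R) -
    (sign_op R (swap_op R (l2_single R n.*2)) : l2 R)); first by [].
  rewrite sign_op_single swap_op_single ABe BAe swap_op_single sign_op_singleS.
  rewrite scaleNr scalerN opprK -mulr2n scalerA nC -natrM scalerMnl.
  by rewrite -mulrnA.
rewrite normrZ l2_single_norm mulr1 normr_nat ler_nat.
by rewrite -mulnA; case: n {ABe DABe BAe DBAe} => // n; rewrite leq_pmulr.
Qed.
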